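(* The $\mathcal{C}$-Coalition Formation problem, parameterized by $\mathrm{vc}+\mathcal{C}$, admits a kernel with $\mathcal{O}(\mathrm{vc}^2\,\mathcal{C})$ vertices, where $\mathrm{vc}$ is the vertex cover number of the input graph.
   Context: $\mathcal{C}$-Coalition Formation (unweighted): the input is an undirected graph $G=(V,E)$ and a capacity $\mathcal{C}\in\mathbb{N}$. A $\mathcal{C}$-partition of $V$ is a partition $\mathcal{P}=\{C_1,\dots,C_p\}$ of $V$ with $|C_i|\le\mathcal{C}$; its value is $v(\mathcal{P})=\sum_{i}|E(G[C_i])|$; the goal is to maximize the value (decision form: decide whether a $\mathcal{C}$-partition of value at least a given $t$ exists). A kernel is a polynomial-time algorithm mapping an instance to an equivalent instance of the same problem whose size is bounded by a function of the parameter. *)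

(* Defs.v *)
From mathcomp Require Import all_boot.

Set Implicit Arguments.
Unset Strict Implicit.
Unset Printing Implicit Defensive.

(* A graph on a finite type T is a symmetric irreflexive relation e : rel T. *)
Section Graphs.

Variables (T : finType) (e : rel T).

(* Undirected edges, as two-element sets of vertices. *)
Definition edges : {set {set T}} :=
  [set A | [exists x, exists y, e x y && (A == [set x; y])]].

Definition induced_edges (C : {set T}) : {set {set T}} :=
  [set A in edges | A \subset C].

Definition vertex_cover (S : {set T}) : bool :=
  [forall x, forall y, e x y ==> (x \in S) || (y \in S)].

Definition vc : nat := #|[arg min_(S < [set: T] | vertex_cover S) #|S|]|.

Definition cpartition (cap : nat) (P : {set {set T}}) : Prop :=
  partition P [set: T] /\ forall C, C \in P -> #|C| <= cap.

Definition value (P : {set {set T}}) : nat := \sum_(C in P) #|induced_edges C|.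

End Graphs.

Record instance : Type := Instance {
  nvert : nat;
  adj : rel 'I_nvert;
  adj_sym : symmetric adj;
  adj_irr : irreflexive adj;
  capacity : nat;
  target : nat
}.

Definition yes_instance (I : instance) : Prop :=
  exists P : {set {set 'I_(nvert I)}},
    cpartition (capacity I) P /\ target I <= value (@adj I) P.

Definition vc_number (I : instance) : nat := vc (@adj I).

Definition parameter (I : instance) : nat := vc_number I + capacity I.

Definition bitlen (k : nat) : nat := (trunc_log 2 k).+1.

(* Bit size of an instance: an adjacency matrix and three binary numbers. *)
Definition instance_size (I : instance) : nat :=
  nvert I ^ 2 + bitlen (nvert I) + bitlen (capacity I) + bitlen (target I).

(* The machine model is the random access machine with logarithmic cost:     *)
(* finitely many registers (those named by the program) and an indirectly    *)
(* addressed memory, both holding natural numbers; the arithmetic consists of*)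
(* addition and truncated subtraction; every instruction is charged the bit  *)
(* lengths of all the numbers it handles, addresses included.  Running times *)
(* are polynomially related to those of Turing machines (Cook and Reckhow).  *)
(* Programs are written with structured control flow instead of jumps.       *)

Record state : Type := State { regs : nat -> nat; memory : nat -> nat }.

Inductive expr : Type :=
  | Const of nat
  | Reg of nat
  | Add of expr & expr
  | Sub of expr & expr.

Fixpoint eval (s : state) (a : expr) : nat :=
  match a with
  | Const k => k
  | Reg x => regs s x
  | Add a1 a2 => eval s a1 + eval s a2
  | Sub a1 a2 => eval s a1 - eval s a2
  end.

Fixpoint cost (s : state) (a : expr) : nat :=
  match a with
  | Const _ | Reg _ => bitlen (eval s a)
  | Add a1 a2 | Sub a1 a2 => cost s a1 + cost s a2 + bitlen (eval s a)
  end.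

Definition update (f : nat -> nat) (x v : nat) : nat -> nat :=
  fun y => if y == x then v else f y.

Definition set_reg (s : state) (x v : nat) : state :=
  State (update (regs s) x v) (memory s).

Definition set_mem (s : state) (p v : nat) : state :=
  State (regs s) (update (memory s) p v).

Inductive cmd : Type :=
  | Skip
  | Assign of nat & expr         (* reg x := a *)
  | Read of nat & expr           (* reg x := memory[a] *)
  | Write of expr & expr         (* memory[a1] := a2 *)
  | Seq of cmd & cmd
  | If of expr & cmd & cmd       (* tests a <> 0 *)
  | While of expr & cmd.         (* loops as long as a <> 0 *)

(* exec c s t s' : started in s, the program c halts in s' after time t. *)
Inductive exec : cmd -> state -> nat -> state -> Prop :=
  | ExecSkip s : exec Skip s 1 s
  | ExecAssign s x a : exec (Assign x a) s (cost s a) (set_reg s x (eval s a))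
  | ExecRead s x a :
      exec (Read x a) s (cost s a + bitlen (memory s (eval s a)))
           (set_reg s x (memory s (eval s a)))
  | ExecWrite s a1 a2 :
      exec (Write a1 a2) s (cost s a1 + cost s a2)
           (set_mem s (eval s a1) (eval s a2))
  | ExecSeq c1 c2 s1 s2 s3 t1 t2 :
      exec c1 s1 t1 s2 -> exec c2 s2 t2 s3 -> exec (Seq c1 c2) s1 (t1 + t2) s3
  | ExecIfTrue a c1 c2 s t s' :
      eval s a <> 0 -> exec c1 s t s' -> exec (If a c1 c2) s (cost s a + t) s'
  | ExecIfFalse a c1 c2 s t s' :
      eval s a = 0 -> exec c2 s t s' -> exec (If a c1 c2) s (cost s a + t) s'
  | ExecWhileDone a c s : eval s a = 0 -> exec (While a c) s (cost s a) s
  | ExecWhileStep a c s1 s2 s3 t1 t2 :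
      eval s1 a <> 0 -> exec c s1 t1 s2 -> exec (While a c) s2 t2 s3 ->
      exec (While a c) s1 (cost s1 a + t1 + t2) s3.

(* Row-major adjacency matrix, 0 outside of the matrix. *)
Definition adj_cell (I : instance) (p : nat) : nat :=
  [exists i : 'I_(nvert I), exists j : 'I_(nvert I),
     (p == i * nvert I + j) && adj i j].

Definition input_state (I : instance) : state :=
  State (nth 0 [:: nvert I; capacity I; target I]) (adj_cell I).

(* The other registers and memory cells may hold anything at the end. *)
Definition outputs (s : state) (I : instance) : Prop :=
  [/\ regs s 0 = nvert I, regs s 1 = capacity I, regs s 2 = target I
    & forall p, p < nvert I ^ 2 -> memory s p = adj_cell I p].

Definition polynomial_time (f : instance -> instance) : Prop :=
  exists (prog : cmd) (c d : nat), forall I : instance,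
    exists (t : nat) (s : state),
      [/\ exec prog (input_state I) t s, outputs s (f I)
        & t <= c * instance_size I ^ d].

(* Bounding the bit size also bounds the parameter of the output. *)
Definition kernel (f : instance -> instance) : Prop :=
  [/\ polynomial_time f,
      forall I, yes_instance (f I) <-> yes_instance I
    & exists g : nat -> nat, forall I, instance_size (f I) <= g (parameter I)].

(* Main.v *)
(** Let X be the vertex set of a maximal matching, a vertex cover with
    |X| <= 2 vc.  In any partition only the blocks meeting X carry edges, and they
    have at most |X| cap vertices together.  So a vertex v of degree greater than
    |X| cap always finds cap - 1 neighbours in edgeless blocks, and forming a
    block with them yields cap - 1 edges, the most that v can ever contribute:
    v is deleted and the target decreased by cap - 1.  Once all degrees are at
    most |X| cap, at most 2 |X|^2 cap vertices are not isolated; only those are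
    kept, and the target is cut to one more than the square of their number.

    Twice the value of a partition is the number of monochromatic ordered pairs of
    adjacent vertices in the corresponding colouring.  Running times are read off
    the program text: if all loops make at most N iterations and all stored values
    are at most M, the time is at most a polynomial in N, of degree the nesting
    depth of the loops, times the bit length of M. *)
Require Import Defs.
From mathcomp Require Import all_boot zify.

Set Implicit Arguments.
Unset Strict Implicit.
Unset Printing Implicit Defensive.

(** * Finite sets and sequences *)

Lemma leq_card_bigcup (I T : finType) (A : {pred I}) (F : I -> {set T}) :
  #|\bigcup_(i in A) F i| <= \sum_(i in A) #|F i|.
Proof.
elim/big_rec2: _ => [|i n B _ leBn]; first by rewrite cards0.
by apply: leq_trans (leq_card_setU _ _) _; rewrite leq_add2l.
Qed.

Lemma card_count_enum (T : finType) (A : {pred T}) : #|A| = count [in A] (enum T).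
Proof. by rewrite cardE -size_filter enumT. Qed.

Lemma set_in_rcons (T : finType) (A : {set T}) (l : seq T) (v : T) :
  [set x in rcons l v | x \in A] =
    if v \in A then v |: [set x in l | x \in A] else [set x in l | x \in A].
Proof.
apply/setP => x; case: ifP => vA; rewrite ?in_setU1 !in_set mem_rcons inE;
  by case: eqVneq => [->|] //=; rewrite vA ?andbF.
Qed.

Lemma filter_allpairs (S T : Type) (P : pred S) (Q : pred T) (s : seq S) (t : seq T) :
  [seq p <- [seq (x, y) | x <- s, y <- t] | P p.1 && Q p.2] =
    [seq (x, y) | x <- filter P s, y <- filter Q t].
Proof.
elim: s => //= x s IHs; rewrite filter_cat IHs filter_map.
case: ifP => Px /=; first by congr (map _ _ ++ _); apply: eq_filter => y /=; rewrite Px.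
by rewrite (eq_filter (a2 := pred0)) ?filter_pred0 // => y /=; rewrite Px.
Qed.

Lemma nth_allpairs (S T R : Type) (f : S -> T -> R) (s : seq S) (t : seq T)
    (x0 : S) (y0 : T) (z0 : R) (i j : nat) :
  i < size s -> j < size t ->
  nth z0 [seq f x y | x <- s, y <- t] (i * size t + j) = f (nth x0 s i) (nth y0 t j).
Proof.
elim: s i => // x s IHs [|i] /= i_lt j_lt; rewrite nth_cat size_map.
  by rewrite j_lt (nth_map y0).
by rewrite mulSn -addnA ltnNge leq_addr addKn IHs.
Qed.

(** * Partitions as colourings *)

Section Graph.

Variables (T : finType) (e : rel T).

Definition neighbours (x : T) : {set T} := [set y | e x y].

Definition achievable (cap t : nat) : Prop :=
  exists P : {set {set T}}, cpartition cap P /\ t <= value e P.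

Definition mono_arcs (L : finType) (f : T -> L) : {set T * T} :=
  [set p | e p.1 p.2 & f p.1 == f p.2].

Definition bounded_classes (L : finType) (cap : nat) (f : T -> L) : Prop :=
  forall l, #|[set x | f x == l]| <= cap.

Lemma achievable_leq (cap t t' : nat) :
  t <= t' -> achievable cap t' -> achievable cap t.
Proof. by move=> tt' [P [capP t'P]]; exists P; split=> //; apply: leq_trans t'P. Qed.

Lemma vertex_coverP (S : {set T}) :
  reflect (forall x y, e x y -> (x \in S) || (y \in S)) (vertex_cover e S).
Proof.
by apply: (iffP 'forall_forallP) => Scov x y; [apply/implyP | apply/implyP/Scov].
Qed.

Lemma exists_vertex_cover_vc : exists2 S, vertex_cover e S & #|S| = vc e.
Proof.
rewrite /vc; case: arg_minnP => [|S Scover _]; last by exists S.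
by apply/vertex_coverP => x y _; rewrite inE.
Qed.

Hypotheses (esym : symmetric e) (eirr : irreflexive e).

Lemma card_induced_arcs (C : {set T}) :
  #|[set p | e p.1 p.2 & (p.1 \in C) && (p.2 \in C)]| = 2 * #|induced_edges e C|.
Proof.
rewrite -sum1_card (partition_big (fun p => [set p.1; p.2])
  [in induced_edges e C]) /=; last first.
  move=> [x y]; rewrite !inE /= subUset !sub1set => /andP[exy ->]; rewrite andbT.
  by apply/existsP; exists x; apply/existsP; exists y; rewrite exy eqxx.
rewrite mulnC -sum_nat_const; apply: eq_bigr => A.
rewrite !inE => /andP[/existsP[x /existsP[y /andP[exy /eqP->]]]].
rewrite subUset !sub1set => /andP[xC yC].
have nxy : x != y by apply: contraTneq exy => ->; rewrite eirr.
rewrite sum1_card -(_ : #|[set (x, y); (y, x)]| = 2); last first.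
  by rewrite cards2 xpair_eqE negb_and nxy.
apply: eq_card => -[a b]; rewrite [LHS]unfold_in !inE /= !xpair_eqE.
apply/idP/idP => [/andP[/andP[eab _] /eqP Eab]|].
  have nab : a != b by apply: contraTneq eab => ->; rewrite eirr.
  have [aA bA] : a \in [set x; y] /\ b \in [set x; y] by rewrite -Eab !inE !eqxx orbT.
  by case/set2P: aA nab => ->; case/set2P: bA => ->; rewrite !eqxx ?orbT.
case/orP=> /andP[/eqP-> /eqP->]; rewrite xC yC ?exy ?eqxx //.
by rewrite esym exy setUC eqxx.
Qed.

Lemma card_mono_arcs_partition (L : finType) (f : T -> L) (P : {set {set T}}) :
    partition P [set: T] -> (forall x y, (f x == f y) = (y \in pblock P x)) ->
  #|mono_arcs f| = 2 * value e P.
Proof.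
move=> /and3P[/eqP covP trivP _] fP.
have inP x : x \in cover P by rewrite covP inE.
rewrite /value big_distrr -sum1_card.
rewrite (partition_big (fun p => pblock P p.1) [in P]) /= => [|p _]; last first.
  exact: pblock_mem.
apply: eq_bigr => C CP; rewrite -card_induced_arcs sum1_card.
apply: eq_card => -[x y]; rewrite [LHS]unfold_in !inE /= fP -andbA.
case: (e x y) => //=; apply/andP/andP => [[yx /eqP <-] | [xC yC]].
  by rewrite mem_pblock inP.
by rewrite (def_pblock trivP CP xC) yC eqxx.
Qed.

Lemma achievableP (cap t : nat) :
  achievable cap t <->
  exists (L : finType) (f : T -> L), bounded_classes cap f /\ 2 * t <= #|mono_arcs f|.
Proof.
split=> [[P [[partP capP] tP]] | [L [f [fcap tf]]]].
  have [/eqP covP trivP _] := and3P partP.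
  have inP x : x \in cover P by rewrite covP inE.
  have fP x y : (pblock P x == pblock P y) = (y \in pblock P x) by rewrite eq_pblock.
  exists {set T}, (pblock P); split; last first.
    by rewrite (card_mono_arcs_partition partP fP) leq_mul2l.
  move=> A; case: (set_0Vmem [set x | pblock P x == A]) => [->|[x]].
    by rewrite cards0.
  rewrite inE => /eqP <-; apply: leq_trans (capP (pblock P x) _).
    by apply/subset_leq_card/subsetP => y; rewrite inE eq_sym fP.
  exact: pblock_mem.
pose P := preim_partition f [set: T].
have partP : partition P [set: T] := preim_partitionP f setT.
have eqf : {in [set: T] & &, equivalence_rel (fun x y => f x == f y)}.
  by split=> [|/eqP ->].
have fP x y : (f x == f y) = (y \in pblock P x).
  by rewrite (pblock_equivalence_partition eqf) ?inE.
exists P; split; last by rewrite (card_mono_arcs_partition partP fP) leq_mul2l in tf.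
split=> // C CP; have [/eqP covP trivP P0] := and3P partP.
have /set0Pn[x xC] : C != set0 by apply: contraNneq P0 => <-.
apply: leq_trans (fcap (f x)); apply/subset_leq_card/subsetP => y yC.
by rewrite inE eq_sym fP (def_pblock trivP CP xC).
Qed.

Lemma achievable_leq_sqr (cap t : nat) : achievable cap t -> t <= #|T| ^ 2.
Proof.
case/achievableP=> L [f [_ tf]].
have: #|mono_arcs f| <= #|T| ^ 2 by rewrite -mulnn -card_prod max_card.
lia.
Qed.

Lemma achievable_minn_sqr (cap t : nat) :
  achievable cap (minn t (#|T| ^ 2).+1) <-> achievable cap t.
Proof.
split; last exact: achievable_leq (geq_minl _ _).
by rewrite /minn; case: ifP => // _ /achievable_leq_sqr; rewrite ltnn.
Qed.

Lemma achievable_cap0 (t : nat) : achievable 0 t <-> #|T| = 0 /\ t = 0.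
Proof.
split=> [ach|[T0 ->]].
  have T0 : #|T| = 0.
    case/achievableP: (ach) => L [f [fcap _]].
    apply: eq_card0 => x; have := fcap (f x).
    by rewrite leqn0 cards_eq0 => /eqP/setP/(_ x); rewrite !inE eqxx.
  by split=> //; have := achievable_leq_sqr ach; rewrite T0; case: t {ach}.
by apply/achievableP; exists T, id; split=> // l; rewrite -T0 max_card.
Qed.

End Graph.

Arguments vertex_coverP {T e S}.

(** * Deleting a vertex of high degree *)

Definition delete (T : finType) (e : rel T) (D : {set T}) : rel T :=
  fun x y => [&& e x y, x \notin D & y \notin D].

Section Delete.

Variables (T : finType) (e : rel T).

Lemma delete_sym (D : {set T}) : symmetric e -> symmetric (delete e D).
Proof. by move=> esym x y; rewrite /delete esym; congr (_ && _); apply: andbC. Qed.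

Lemma delete_irr (D : {set T}) : irreflexive e -> irreflexive (delete e D).
Proof. by move=> eirr x; rewrite /delete eirr. Qed.

Lemma delete0 : delete e set0 =2 e.
Proof. by move=> x y; rewrite /delete !inE andbT. Qed.

Lemma deleteU (A B : {set T}) : delete e (A :|: B) =2 delete (delete e B) A.
Proof.
move=> x y; rewrite /delete !inE !negb_or.
by case: (e x y) (x \in A) (x \in B) (y \in A) (y \in B) => [] [] [] [] [].
Qed.

Lemma eq_achievable (e' : rel T) (cap t : nat) :
  e =2 e' -> achievable e cap t <-> achievable e' cap t.
Proof.
move=> ee'; suff valueE P : value e P = value e' P.
  by split=> -[P [capP tP]]; exists P; split; rewrite // ?valueE // -valueE.
apply: eq_bigr => C _; apply: eq_card => A; rewrite !inE; congr (_ && _).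
by apply: eq_existsb => x; apply: eq_existsb => y; rewrite ee'.
Qed.

Lemma vertex_cover_delete (S D : {set T}) :
  vertex_cover e S -> vertex_cover (delete e D) (S :\: D).
Proof.
move=> /vertex_coverP Scov; apply/vertex_coverP => x y /and3P[exy xD yD].
by rewrite !inE xD yD Scov.
Qed.

Lemma neighbours_delete_deleted (D : {set T}) (x : T) :
  x \in D -> neighbours (delete e D) x = set0.
Proof. by move=> xD; apply/setP => y; rewrite !inE /delete xD andbF. Qed.

Lemma neighbours_deleteS (D D' : {set T}) (x : T) : D \subset D' ->
  neighbours (delete e D') x \subset neighbours (delete e D) x.
Proof.
move=> /subsetP DD'; apply/subsetP => y; rewrite !inE => /and3P[exy xD yD].
by apply/and3P; split=> //; [apply: contraNN xD | apply: contraNN yD]; apply: DD'.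
Qed.

End Delete.

Section Colouring.

Variables (T L : finType) (e : rel T) (f : T -> L).

Definition saturation (S : {set T}) : {set T} :=
  \bigcup_(x in S) [set y | f y == f x].

Definition isolate (A : {set T}) (x : T) : option L :=
  if x \in A then None else Some (f x).

Lemma card_saturation (cap : nat) (S : {set T}) :
  bounded_classes cap f -> #|saturation S| <= #|S| * cap.
Proof.
move=> fcap; apply: leq_trans (leq_card_bigcup _ _) _.
by rewrite -sum_nat_const leq_sum.
Qed.

Lemma mono_arc_saturation (S : {set T}) (x y : T) :
    vertex_cover e S -> e x y -> f x = f y ->
  (x \in saturation S) && (y \in saturation S).
Proof.
move=> /vertex_coverP Scov /Scov xyS fxy.
by apply/andP; split; apply/bigcupP; case/orP: xyS => zS;
  [exists x | exists y | exists x | exists y]; rewrite // inE ?fxy.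
Qed.

Lemma bounded_classes_isolate (cap : nat) (A : {set T}) :
  bounded_classes cap f -> #|A| <= cap -> bounded_classes cap (isolate A).
Proof.
move=> fcap Acap [l|]; rewrite /isolate.
  apply: leq_trans (fcap l); apply/subset_leq_card/subsetP => x.
  by rewrite !inE; case: ifP.
by apply: leq_trans Acap; apply/subset_leq_card/subsetP => x; rewrite inE; case: ifP.
Qed.

Lemma mono_arcs_isolate (A : {set T}) :
    (forall x y, e x y -> f x = f y -> (x \notin A) && (y \notin A)) ->
  mono_arcs e f \subset mono_arcs e (isolate A).
Proof.
move=> monoA; apply/subsetP => -[x y]; rewrite !inE /= /isolate => /andP[exy /eqP fxy].
by have /andP[/negPf-> /negPf->] := monoA _ _ exy fxy; rewrite exy fxy eqxx.
Qed.

Lemma card_mono_arcs_delete (v : T) : symmetric e -> irreflexive e ->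
  #|mono_arcs e f| =
    #|mono_arcs (delete e [set v]) f| + 2 * #|[set y in neighbours e v | f y == f v]|.
Proof.
move=> esym eirr; set A := [set y in _ | _].
rewrite -(cardsID [set p | p.1 == v]) -(cardsID [set p | p.2 == v] (_ :\: _)).
have -> : mono_arcs e f :&: [set p | p.1 == v] = setX [set v] A.
  apply/setP=> -[x y]; rewrite !inE /= andbC.
  by case: eqVneq => //= ->; rewrite [f v == _]eq_sym.
have -> : (mono_arcs e f :\: [set p | p.1 == v]) :&: [set p | p.2 == v]
            = setX A [set v].
  apply/setP=> -[x y]; rewrite !inE /= andbC.
  case: (eqVneq y v) => [->|]; rewrite ?andbF //= andbT esym.
  by case: (eqVneq x v) => [->|]; rewrite ?eirr.
have -> : mono_arcs e f :\: [set p | p.1 == v] :\: [set p | p.2 == v]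
            = mono_arcs (delete e [set v]) f.
  apply/setP=> -[x y]; rewrite !inE /= /delete !inE.
  by case: (e x y) (x == v) (y == v) => [] [] [].
by rewrite !cardsX cards1 mul1n muln1 addnA addnn -mul2n addnC.
Qed.

End Colouring.

Section HighDegree.

Variables (T : finType) (e : rel T) (cap : nat) (S : {set T}) (v : T).
Hypotheses (esym : symmetric e) (eirr : irreflexive e).

Lemma achievable_delete (t : nat) :
  achievable e cap t -> achievable (delete e [set v]) cap (t - cap.-1).
Proof.
have [dsym dirr] := (delete_sym [set v] esym, delete_irr [set v] eirr).
move=> /achievableP[//|//|L [f [fcap tf]]]; apply/achievableP => //.
exists L, f; split=> //; move: tf; rewrite (card_mono_arcs_delete f v) //.
set A := [set y in _ | _]; suff : #|A| < cap by lia.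
apply: leq_trans (fcap (f v)); rewrite (cardsD1 v [set x | _]) inE eqxx ltnS.
apply/subset_leq_card/subsetP => y; rewrite !inE => /andP[evy ->]; rewrite andbT.
by apply: contraTneq evy => ->; rewrite eirr.
Qed.

Hypothesis Scover : vertex_cover e S.
Hypothesis v_high : #|S| * cap < #|neighbours e v|.

Lemma exists_unsaturated_neighbours (L : finType) (f : T -> L) :
    0 < cap -> bounded_classes cap f ->
  exists A : {set T},
    [/\ A \subset neighbours e v, [disjoint A & saturation f (S :\ v)]
      & #|A| = cap.-1].
Proof.
move=> cap_gt0 fcap; have vS : v \in S.
  apply: contraTT v_high => vS; rewrite -leqNgt; apply: leq_trans (leq_pmulr _ cap_gt0).
  apply/subset_leq_card/subsetP => y; rewrite inE => /(vertex_coverP Scover).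
  by rewrite (negPf vS).
have /card_geqP[s [s_uniq s_size /subsetP sA]] :
    cap.-1 <= #|neighbours e v :\: saturation f (S :\ v)|.
  have := card_saturation (S :\ v) fcap; move: v_high; rewrite (cardsD1 v S) vS.
  rewrite -(cardsID (saturation f (S :\ v)) (neighbours e v)).
  have := subset_leq_card (subsetIr (neighbours e v) (saturation f (S :\ v))).
  lia.
have {}sA : [set x in s] \subset neighbours e v :\: saturation f (S :\ v).
  by apply/subsetP => x; rewrite inE => /(subsetP sA).
move: sA; rewrite subsetD => /andP[sN s_disj].
by exists [set x in s]; rewrite cardsE (card_uniqP s_uniq).
Qed.

(* Some cap - 1 neighbours of v lie in no class carrying an edge of the graph
   without v, so that moving them to a new class with v loses no edge. *)
Lemma achievable_undelete_high (t : nat) : 0 < cap ->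
  achievable (delete e [set v]) cap t -> achievable e cap (t + cap.-1).
Proof.
have [dsym dirr] := (delete_sym [set v] esym, delete_irr [set v] eirr).
move=> cap_gt0 /achievableP[//|//|L [f [fcap tf]]]; apply/achievableP => //.
have [A [AN AS cardA]] := exists_unsaturated_neighbours cap_gt0 fcap.
have vA : v \notin A by apply/negP => /(subsetP AN); rewrite inE eirr.
exists (option L), (isolate f (v |: A)); split.
  by apply: bounded_classes_isolate; rewrite // cardsU1 vA cardA; lia.
rewrite (card_mono_arcs_delete _ v) // mulnDr leq_add //; last first.
  rewrite leq_mul2l -cardA; apply/subset_leq_card/subsetP => y yA.
  by have := subsetP AN y yA; rewrite !inE => ->; rewrite /isolate !in_setU1 eqxx yA orbT.
apply: leq_trans tf _; apply/subset_leq_card/mono_arcs_isolate => x y exy fxy.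
have /andP[xS yS] := mono_arc_saturation (vertex_cover_delete [set v] Scover) exy fxy.
case/and3P: exy => _; rewrite !inE => /negPf-> /negPf-> /=.
have notA z : z \in saturation f (S :\ v) -> z \notin A by move/(disjointFl AS)->.
by rewrite !notA.
Qed.

Lemma achievable_delete_high (t : nat) :
  achievable e cap t <-> achievable (delete e [set v]) cap (t - cap.-1).
Proof.
split; first exact: achievable_delete.
case: (posnP cap) => [->|cap_gt0]; last first.
  by move/(achievable_undelete_high cap_gt0); apply: achievable_leq; lia.
have [dsym dirr] := (delete_sym [set v] esym, delete_irr [set v] eirr).
by move/achievable_cap0 => [//|//|/card0_eq/(_ v)].
Qed.

End HighDegree.

Section Embedding.

Variables (U T : finType) (e : rel T) (h : U -> T).
Hypotheses (h_inj : injective h) (h_cover : forall x y, e x y -> x \in codom h).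
Hypotheses (esym : symmetric e) (eirr : irreflexive e).

Lemma relpre_sym : symmetric (relpre h e).
Proof. by move=> x y; apply: esym. Qed.

Lemma relpre_irr : irreflexive (relpre h e).
Proof. by move=> x; apply: eirr. Qed.

Lemma card_mono_arcs_relpre (L : finType) (f : T -> L) :
  #|mono_arcs (relpre h e) (f \o h)| = #|mono_arcs e f|.
Proof.
have hh_inj : injective (fun p : U * U => (h p.1, h p.2)).
  by move=> [a b] [c d] [/h_inj-> /h_inj->].
rewrite -(card_imset _ hh_inj); apply: eq_card => -[x y]; rewrite !inE.
apply/imsetP/andP => [[[a b]]|/= [exy fxy]]; first by rewrite inE => /andP[? ?] [-> ->].
have /codomP[a xa] := h_cover exy.
have /codomP[b yb] : y \in codom h by apply: (h_cover (y := x)); rewrite esym.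
by exists (a, b); rewrite ?inE /= -xa -yb ?exy.
Qed.

(* A nonempty graph has no partition into blocks of size 0, even if all its
   vertices are isolated; hence the correction of the target. *)
Lemma achievable_relpre (cap t : nat) :
  achievable (relpre h e) cap (t + (minn 1 #|T| - cap)) <-> achievable e cap t.
Proof.
have [rsym rirr] := (relpre_sym, relpre_irr).
case: (posnP cap) => [->|cap_gt0].
  rewrite !achievable_cap0 //; have := leq_card h h_inj; lia.
rewrite (_ : _ - cap = 0) ?addn0; last by lia.
rewrite !achievableP //; split=> -[L [f [fcap tf]]]; last first.
  exists L, (f \o h); rewrite card_mono_arcs_relpre; split=> // l.
  apply: leq_trans (fcap l); rewrite -(card_imset _ h_inj).
  by apply/subset_leq_card/subsetP => _ /imsetP[a + ->]; rewrite !inE.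
pose g x := if [pick a | h a == x] is Some a then inl (f a) else inr x : L + T.
have gh a : g (h a) = inl (f a).
  by rewrite /g; case: pickP => [b /eqP/h_inj-> //|/(_ a)]; rewrite eqxx.
exists (L + T)%type, g; split=> [[l|x]|].
- apply: leq_trans (fcap l); rewrite -(card_imset _ h_inj).
  apply/subset_leq_card/subsetP => x; rewrite inE /g.
  by case: pickP => // a /eqP <- /eqP[fa]; rewrite imset_f // inE fa.
- apply: leq_trans cap_gt0; rewrite -(cards1 x).
  apply/subset_leq_card/subsetP => y; rewrite !inE /g.
  by case: pickP => // _ /eqP[->].
rewrite -card_mono_arcs_relpre; apply: leq_trans tf _.
by apply/subset_leq_card/subsetP => -[a b]; rewrite !inE /= !gh.
Qed.

End Embedding.

(** * The kernel *)

Definition row_major (T : finType) : seq (T * T) :=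
  [seq (x, y) | x <- enum T, y <- enum T].

Section GreedyMatching.

Variables (T : finType) (e : rel T).

Definition match_pair (X : {set T}) (p : T * T) : {set T} :=
  if [&& e p.1 p.2, p.1 \notin X & p.2 \notin X] then p.1 |: (p.2 |: X) else X.

Definition matched_by (s : seq (T * T)) : {set T} := foldl match_pair set0 s.

Definition matched : {set T} := matched_by (row_major T).

Lemma matched_by_rcons (s : seq (T * T)) (p : T * T) :
  matched_by (rcons s p) = match_pair (matched_by s) p.
Proof. exact: foldl_rcons. Qed.

Lemma sub_match_pair (X : {set T}) (p : T * T) : X \subset match_pair X p.
Proof. by rewrite /match_pair; case: ifP => // _; rewrite setUA subsetUr. Qed.

Lemma matched_by_cover (s : seq (T * T)) (p : T * T) :
  p \in s -> e p.1 p.2 -> (p.1 \in matched_by s) || (p.2 \in matched_by s).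
Proof.
move=> + ep; elim/last_ind: s => // s q IHs.
rewrite mem_rcons inE matched_by_rcons => /predU1P[<-|/IHs].
  rewrite /match_pair ep /=; case: ifP => [_|]; first by rewrite !inE eqxx.
  by move/negbT; rewrite negb_and !negbK.
by case/orP => /(subsetP (sub_match_pair _ q)) ->; rewrite ?orbT.
Qed.

Lemma vertex_cover_matched : vertex_cover e matched.
Proof.
apply/vertex_coverP => x y exy; apply: (@matched_by_cover _ (x, y)) => //.
by apply: allpairs_f; rewrite mem_enum.
Qed.

Hypothesis eirr : irreflexive e.

Lemma card_match_pair (X : {set T}) (x y : T) :
    e x y -> x \notin X -> y \notin X ->
  #|match_pair X (x, y)| = #|X|.+2.
Proof.
move=> exy xX yX; have nxy : x != y by apply: contraTneq exy => ->; rewrite eirr.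
by rewrite /match_pair exy xX yX !cardsU1 in_setU1 negb_or nxy xX yX.
Qed.

Lemma card_matched_by (S : {set T}) (s : seq (T * T)) :
  vertex_cover e S -> #|matched_by s| <= 2 * #|matched_by s :&: S|.
Proof.
move=> /vertex_coverP Scov; elim/last_ind: s => [|s [x y] IHs]; first by rewrite cards0.
rewrite matched_by_rcons; set X := matched_by s in IHs *.
case: (boolP [&& e x y, x \notin X & y \notin X]) => [/and3P[exy xX yX]|]; last first.
  by rewrite /match_pair /= => /negPf->.
rewrite (card_match_pair exy xX yX) /match_pair exy xX yX /=.
suff : #|X :&: S| < #|(x |: (y |: X)) :&: S| by lia.
have sub : X :&: S \subset (x |: (y |: X)) :&: S by rewrite setSI // setUA subsetUr.
by apply: proper_card; apply/properP; split=> //;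
  case/orP: (Scov _ _ exy) => zS; [exists x | exists y]; 
  rewrite !inE ?eqxx ?orbT ?zS // ?(negPf xX) ?(negPf yX).
Qed.

Lemma card_matched : #|matched| <= 2 * vc e.
Proof.
have [S Scov <-] := exists_vertex_cover_vc e.
apply: leq_trans (card_matched_by _ Scov) _.
by rewrite leq_mul2l subset_leq_card ?subsetIr.
Qed.

End GreedyMatching.

Section Pruning.

Variables (T : finType) (e : rel T) (d : nat).

Definition prune_vertex (D : {set T}) (v : T) : {set T} :=
  if d < #|neighbours (delete e D) v| then v |: D else D.

Definition pruned_by (s : seq T) : {set T} := foldl prune_vertex set0 s.

Definition pruned : {set T} := pruned_by (enum T).

Lemma pruned_by_rcons (s : seq T) (v : T) :
  pruned_by (rcons s v) = prune_vertex (pruned_by s) v.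
Proof. exact: foldl_rcons. Qed.

Lemma sub_prune_vertex (D : {set T}) (v : T) : D \subset prune_vertex D v.
Proof. by rewrite /prune_vertex; case: ifP => // _; rewrite subsetUr. Qed.

Lemma high_degree_notin (D : {set T}) (v : T) :
  d < #|neighbours (delete e D) v| -> v \notin D.
Proof. by apply: contraTN => /neighbours_delete_deleted->; rewrite cards0. Qed.

Lemma degree_pruned_by (s : seq T) (v : T) :
  v \in s -> #|neighbours (delete e (pruned_by s)) v| <= d.
Proof.
elim/last_ind: s => // s w IHs; rewrite mem_rcons inE pruned_by_rcons.
case/predU1P => [<-|/IHs]; last first.
  exact/leq_trans/subset_leq_card/neighbours_deleteS/sub_prune_vertex.
rewrite /prune_vertex; case: ltnP => // _.
by rewrite neighbours_delete_deleted ?cards0 // setU11.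
Qed.

Lemma degree_pruned (v : T) : #|neighbours (delete e pruned) v| <= d.
Proof. by apply: degree_pruned_by; rewrite mem_enum. Qed.

Lemma achievable_pruned_by (S : {set T}) (cap t : nat) (s : seq T) :
    symmetric e -> irreflexive e -> vertex_cover e S -> #|S| * cap <= d ->
  achievable e cap t <->
    achievable (delete e (pruned_by s)) cap (t - #|pruned_by s| * cap.-1).
Proof.
move=> esym eirr Scov Sd; elim/last_ind: s => [|s v ->].
  by rewrite cards0 subn0; apply/eq_achievable => x y; rewrite delete0.
rewrite pruned_by_rcons /prune_vertex; set D := pruned_by s.
case: ltnP => // v_high; rewrite cardsU1 high_degree_notin // mulSn addnC subnDA.
rewrite (eq_achievable _ _ (deleteU _ _ _)).
apply: (achievable_delete_high (S := S :\: D));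
  [exact: delete_sym | exact: delete_irr | exact: vertex_cover_delete |].
apply: leq_ltn_trans v_high; apply: leq_trans Sd.
by rewrite leq_mul2r subset_leq_card ?subsetDl ?orbT.
Qed.

End Pruning.

Definition nonisolated (T : finType) (e : rel T) : {set T} :=
  [set x | 0 < #|neighbours e x|].

Lemma card_nonisolated (T : finType) (e : rel T) (S : {set T}) (d : nat) :
    symmetric e -> vertex_cover e S -> (forall x, #|neighbours e x| <= d) ->
  #|nonisolated e| <= 2 * (#|S| * d).
Proof.
move=> esym /vertex_coverP Scov ed.
have sub : nonisolated e
    \subset (S :&: nonisolated e) :|: \bigcup_(x in S) neighbours e x.
  apply/subsetP => x xe; rewrite in_setU in_setI xe andbT.
  move: xe; rewrite inE => /card_gt0P[y]; rewrite inE => exy.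
  case/orP: (Scov _ _ exy) => [-> //|yS]; apply/orP; right.
  by apply/bigcupP; exists y; rewrite // inE esym.
apply: leq_trans (subset_leq_card sub) _; apply: leq_trans (leq_card_setU _ _) _.
have degS : \sum_(x in S) #|neighbours e x| <= #|S| * d by rewrite -sum_nat_const leq_sum.
rewrite mul2n -addnn leq_add ?(leq_trans (leq_card_bigcup _ _)) //.
apply: leq_trans degS; rewrite -sum1_card big_mkcond [leqRHS]big_mkcond.
apply: leq_sum => x _; rewrite !inE; case: (x \in S) => //=.
by case: ifP.
Qed.

Section Kernelize.

Variable I : instance.

Let n := nvert I.
Let e : rel 'I_n := @adj I.

Definition deleted : {set 'I_n} := pruned e (#|matched e| * capacity I).

Definition reduced_adj : rel 'I_n := delete e deleted.

Definition kept : {set 'I_n} := nonisolated reduced_adj.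

Definition kernel_adj : rel 'I_#|kept| := relpre enum_val reduced_adj.

Definition kernel_target : nat :=
  minn (target I - #|deleted| * (capacity I).-1 + (minn 1 n - capacity I))
       (#|kept| ^ 2).+1.

Lemma reduced_adj_sym : symmetric reduced_adj.
Proof. exact/delete_sym/adj_sym. Qed.

Lemma reduced_adj_irr : irreflexive reduced_adj.
Proof. exact/delete_irr/adj_irr. Qed.

Definition kernelize : instance :=
  @Instance #|kept| kernel_adj (relpre_sym _ reduced_adj_sym)
    (relpre_irr _ reduced_adj_irr) (capacity I) kernel_target.

Lemma kept_codom (x y : 'I_n) :
  reduced_adj x y -> x \in codom (enum_val : 'I_#|kept| -> 'I_n).
Proof.
move=> xy; have x_kept : x \in kept.
  by rewrite inE; apply/card_gt0P; exists y; rewrite inE.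
by rewrite -(enum_rankK_in x_kept x_kept) codom_f.
Qed.

Lemma kernelize_equivalent : yes_instance kernelize <-> yes_instance I.
Proof.
have [esym eirr] := (@adj_sym I, @adj_irr I).
have [rsym rirr] := (reduced_adj_sym, reduced_adj_irr).
have prune := achievable_pruned_by (target I) (enum 'I_n) esym eirr
  (vertex_cover_matched e) (leqnn (_ * capacity I)).
have embed := achievable_relpre enum_val_inj kept_codom rsym rirr (capacity I)
  (target I - #|deleted| * (capacity I).-1).
have truncate := achievable_minn_sqr (adj_sym (i := kernelize)) (adj_irr (i := kernelize))
  (capacity I) (target I - #|deleted| * (capacity I).-1 + (minn 1 n - capacity I)).
rewrite !card_ord in embed truncate.
exact: iff_trans truncate (iff_trans embed (iff_sym prune)).
Qed.

Lemma nvert_kernelize : nvert kernelize <= 8 * (vc_number I ^ 2 * capacity I).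
Proof.
set X := matched e; have Xvc : #|X| <= 2 * vc_number I by apply/card_matched/adj_irr.
have red_cover := vertex_cover_delete deleted (vertex_cover_matched e).
apply: leq_trans (card_nonisolated reduced_adj_sym red_cover (degree_pruned _ _)) _.
have X'vc : #|X :\: deleted| <= 2 * vc_number I.
  exact: leq_trans (subset_leq_card (subsetDl _ _)) Xvc.
apply: (@leq_trans (2 * (2 * vc_number I * (2 * vc_number I) * capacity I))).
  by rewrite leq_mul2l mulnA leq_mul2r (leq_mul X'vc Xvc) orbT.
by rewrite -mulnn; lia.
Qed.

End Kernelize.

(** * Bit lengths *)

Lemma ltn_bitlen (k : nat) : k < 2 ^ bitlen k.
Proof. exact: trunc_log_ltn. Qed.

Lemma bitlen_leq (k b : nat) : 0 < b -> k < 2 ^ b -> bitlen k <= b.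
Proof.
move=> b_gt0 kb; case: (posnP k) => [->|k_gt0]; first by rewrite /bitlen trunc_log0.
by rewrite -(ltn_exp2l _ _ (isT : 1 < 2)); apply: leq_ltn_trans (trunc_logP _ k_gt0) kb.
Qed.

Lemma bitlen_mono (k l : nat) : k <= l -> bitlen k <= bitlen l.
Proof. by move=> kl; apply: bitlen_leq => //; apply: leq_ltn_trans kl (ltn_bitlen l). Qed.

Lemma bitlenM (k l : nat) : bitlen (k * l) <= bitlen k + bitlen l.
Proof. by apply: bitlen_leq; rewrite // expnD ltn_mul ?ltn_bitlen. Qed.

Lemma bitlenD (k l : nat) : bitlen (k + l) <= bitlen k + bitlen l.
Proof.
have ge2 m : 2 <= 2 ^ bitlen m by rewrite -[2 in leqLHS]expn1 leq_exp2l.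
apply: bitlen_leq; rewrite // expnD.
have := ltn_bitlen k; have := ltn_bitlen l; have := ge2 k; have := ge2 l; nia.
Qed.

(** * Total correctness with time bounds *)

#[local] Arguments update f x v y /.

Local Notation "a [+] b" := (Add a b) (at level 50, left associativity).
Local Notation "a [-] b" := (Defs.Sub a b) (at level 50, left associativity).
Local Notation "x ::= a" := (Assign x a) (at level 60).
Local Notation "c1 ;; c2" := (Seq c1 c2) (at level 65, right associativity).

Fixpoint assigned (c : cmd) : seq nat :=
  match c with
  | Assign x _ | Read x _ => [:: x]
  | c1 ;; c2 | If _ c1 c2 => assigned c1 ++ assigned c2
  | While _ c1 => assigned c1
  | Skip | Write _ _ => [::]
  end.

Fixpoint writes (c : cmd) : bool :=
  match c with
  | Write _ _ => true
  | c1 ;; c2 | If _ c1 c2 => writes c1 || writes c2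
  | While _ c1 => writes c1
  | Skip | Assign _ _ | Read _ _ => false
  end.

Definition frame (c : cmd) (s s' : state) : Prop :=
  (forall x, x \notin assigned c -> regs s' x = regs s x) /\
  (~~ writes c -> memory s' = memory s).

Lemma frame_trans (c : cmd) (s1 s2 s3 : state) :
  frame c s1 s2 -> frame c s2 s3 -> frame c s1 s3.
Proof.
by move=> [r1 m1] [r2 m2]; split=> [x xc|wc]; [rewrite r2 ?r1 | rewrite m2 ?m1].
Qed.

Lemma frame_weaken (c c' : cmd) (s s' : state) :
    {subset assigned c <= assigned c'} -> (writes c -> writes c') ->
  frame c s s' -> frame c' s s'.
Proof.
move=> sub w [r m]; split=> [x xc'|wc']; first by rewrite r // (contra (@sub x)).
by rewrite m // (contra w).
Qed.

Lemma exec_frame (c : cmd) (s : state) (t : nat) (s' : state) :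
  exec c s t s' -> frame c s s'.
Proof.
have catl (l1 l2 : seq nat) : {subset l1 <= l1 ++ l2}.
  by move=> x xl; rewrite mem_cat xl.
have catr (l1 l2 : seq nat) : {subset l2 <= l1 ++ l2}.
  by move=> x xl; rewrite mem_cat xl orbT.
elim=> {c s t s'} //=.
- by move=> s x a; split=> //= y; rewrite inE => /negPf->.
- by move=> s x a; split=> //= y; rewrite inE => /negPf->.
- move=> c1 c2 s1 s2 s3 _ _ _ frame1 _ frame2.
  by apply: frame_trans (frame_weaken _ _ frame1) (frame_weaken _ _ frame2) => //= ->;
    rewrite ?orbT.
- by move=> a c1 c2 s _ s' _ _; apply: frame_weaken => //= ->.
- by move=> a c1 c2 s _ s' _ _; apply: frame_weaken => //= ->; rewrite orbT.
- by move=> a c s1 s2 s3 _ _ _ _ frame1 _; apply: frame_trans.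
Qed.

Fixpoint width (a : expr) : nat :=
  match a with
  | Const k => bitlen k
  | Reg _ => 1
  | a1 [+] a2 => width a1 + width a2
  | a1 [-] _ => width a1
  end.

Fixpoint expr_time (a : expr) : nat :=
  match a with
  | Const _ | Reg _ => width a
  | a1 [+] a2 | a1 [-] a2 => expr_time a1 + expr_time a2 + width a
  end.

(* The time of a program all of whose loops make at most N iterations, in
   units of the bit length of the largest stored value. *)
Fixpoint time_bound (N : nat) (c : cmd) : nat :=
  match c with
  | Skip => 1
  | _ ::= a => expr_time a
  | Read _ a => expr_time a + 1
  | Write a1 a2 => expr_time a1 + expr_time a2
  | c1 ;; c2 => time_bound N c1 + time_bound N c2
  | If a c1 c2 => expr_time a + (time_bound N c1 + time_bound N c2)
  | While a c1 => N.+1 * (expr_time a + time_bound N c1)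
  end.

Fixpoint loop_depth (c : cmd) : nat :=
  match c with
  | c1 ;; c2 | If _ c1 c2 => maxn (loop_depth c1) (loop_depth c2)
  | While _ c1 => (loop_depth c1).+1
  | _ => 0
  end.

Lemma time_bound_leq (N : nat) (c : cmd) :
  time_bound N c <= time_bound 0 c * N.+1 ^ loop_depth c.
Proof.
have widen d d' k l : d <= d' -> k <= l * N.+1 ^ d -> k <= l * N.+1 ^ d'.
  by move=> dd' /leq_trans->; rewrite // leq_mul2l leq_pexp2l ?orbT.
elim: c => [|x a|x a|a1 a2|c1 IH1 c2 IH2|a c1 IH1 c2 IH2|a c1 IH1] /=; rewrite ?muln1 //.
- rewrite mulnDl leq_add //.
    exact: widen (leq_maxl _ _) IH1.
  exact: widen (leq_maxr _ _) IH2.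
- rewrite !mulnDl !leq_add ?leq_pmulr ?expn_gt0 //.
    exact: widen (leq_maxl _ _) IH1.
  exact: widen (leq_maxr _ _) IH2.
- rewrite mul1n expnS mulnCA leq_mul2l /= mulnDl leq_add //.
  by rewrite leq_pmulr ?expn_gt0.
Qed.

Definition incr (x : nat) : cmd := x ::= Reg x [+] Const 1.

Definition For (x b : nat) (c : cmd) : cmd :=
  x ::= Const 0 ;; While (Reg b [-] Reg x) (c ;; incr x).

Section Triples.

Variables M N : nat.

Definition bounded (s : state) : Prop :=
  (forall x, regs s x <= M) /\ (forall p, memory s p <= M).

Definition wp (c : cmd) (s : state) (Q : state -> Prop) : Prop :=
  bounded s -> exists t s',
    [/\ exec c s t s', t <= time_bound N c * bitlen M, bounded s' & Q s'].

Implicit Types (Q : state -> Prop) (s : state) (a : expr) (c : cmd).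

Lemma bitlen_eval s a : bounded s -> bitlen (eval s a) <= width a * bitlen M.
Proof.
move=> [rM _]; elim: a => [k|x|a1 IH1 a2 IH2|a1 IH1 a2 IH2] /=.
- by rewrite leq_pmulr.
- by rewrite mul1n bitlen_mono.
- by rewrite mulnDl; apply: leq_trans (bitlenD _ _) _; apply: leq_add.
- by apply: leq_trans IH1; rewrite bitlen_mono ?leq_subr.
Qed.

Lemma cost_leq s a : bounded s -> cost s a <= expr_time a * bitlen M.
Proof.
move=> sM; have evalM b := bitlen_eval b sM.
elim: a => [k|x|a1 IH1 a2 IH2|a1 IH1 a2 IH2] /=; rewrite ?mulnDl ?leq_add //.
- exact: (evalM (Const k)).
- exact: (evalM (Reg x)).
- by rewrite -mulnDl (evalM (a1 [+] a2)).
- exact: (evalM (a1 [-] a2)).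
Qed.

Lemma bounded_set_reg s (x v : nat) : bounded s -> v <= M -> bounded (set_reg s x v).
Proof. by move=> [rM mM] vM; split=> //= y; case: ifP. Qed.

Lemma bounded_set_mem s (p v : nat) : bounded s -> v <= M -> bounded (set_mem s p v).
Proof. by move=> [rM mM] vM; split=> //= y; case: ifP. Qed.

Lemma wp_conseq c s Q Q' : wp c s Q -> (forall s', Q s' -> Q' s') -> wp c s Q'.
Proof. by move=> wpQ QQ' sM; have [t [s' [? ? ? /QQ' ?]]] := wpQ sM; exists t, s'. Qed.

Lemma wp_frame c s Q : wp c s (fun s' => frame c s s' -> Q s') -> wp c s Q.
Proof.
move=> wpQ sM; have [t [s' [ex t_le s'M Qs']]] := wpQ sM.
by exists t, s'; split=> //; apply/Qs'/exec_frame/ex.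
Qed.

Lemma wp_skip s Q : Q s -> wp Skip s Q.
Proof. by move=> Qs sM; exists 1, s; split=> //; constructor. Qed.

Lemma wp_assign s (x : nat) a Q :
  eval s a <= M -> Q (set_reg s x (eval s a)) -> wp (x ::= a) s Q.
Proof.
move=> aM Qs sM; do 2!eexists; split; [constructor | | | exact: Qs].
  exact: cost_leq.
exact: bounded_set_reg.
Qed.

Lemma wp_read s (x : nat) a Q :
  Q (set_reg s x (memory s (eval s a))) -> wp (Read x a) s Q.
Proof.
move=> Qs sM; have [_ mM] := sM; do 2!eexists; split; [constructor | | | exact: Qs].
  by rewrite /= mulnDl mul1n leq_add ?cost_leq ?bitlen_mono.
exact: bounded_set_reg.
Qed.

Lemma wp_write s a1 a2 Q :
  eval s a2 <= M -> Q (set_mem s (eval s a1) (eval s a2)) -> wp (Write a1 a2) s Q.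
Proof.
move=> aM Qs sM; do 2!eexists; split; [constructor | | | exact: Qs].
  by rewrite /= mulnDl leq_add ?cost_leq.
exact: bounded_set_mem.
Qed.

Lemma wp_seq c1 c2 s Q : wp c1 s (fun s' => wp c2 s' Q) -> wp (c1 ;; c2) s Q.
Proof.
move=> wp1 sM; have [t1 [s1 [ex1 t1_le s1M wp2]]] := wp1 sM.
have [t2 [s2 [ex2 t2_le s2M Qs2]]] := wp2 s1M.
exists (t1 + t2), s2; split=> //; first exact: ExecSeq ex1 ex2.
by rewrite /= mulnDl leq_add.
Qed.

Lemma wp_if a c1 c2 s Q :
  (eval s a <> 0 -> wp c1 s Q) -> (eval s a = 0 -> wp c2 s Q) -> wp (If a c1 c2) s Q.
Proof.
move=> wp1 wp2 sM; have aM := cost_leq a sM.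
case: (eqVneq (eval s a) 0) => [a0 | /eqP a0].
  have [t [s' [ex t_le s'M Qs']]] := wp2 a0 sM.
  exists (cost s a + t), s'; split=> //; first exact: ExecIfFalse.
  by rewrite /= !mulnDl leq_add // (leq_trans t_le) // leq_addl.
have [t [s' [ex t_le s'M Qs']]] := wp1 a0 sM.
exists (cost s a + t), s'; split=> //; first exact: ExecIfTrue.
by rewrite /= !mulnDl leq_add // (leq_trans t_le) // leq_addr.
Qed.

(* The invariant is indexed by the number of iterations to come. *)
Lemma wp_while a c (k : nat) s (Inv : nat -> state -> Prop) Q :
    k <= N -> Inv k s ->
    (forall i s', Inv i.+1 s' -> eval s' a <> 0 /\ wp c s' (Inv i)) ->
    (forall s', Inv 0 s' -> eval s' a = 0 /\ Q s') ->
  wp (While a c) s Q.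
Proof.
move=> kN Ik step stop sM.
suff [t [s' [ex t_le s'M Qs']]] : exists t s', [/\ exec (While a c) s t s',
    t <= k.+1 * ((expr_time a + time_bound N c) * bitlen M), bounded s' & Q s'].
  exists t, s'; split=> //; apply: leq_trans t_le _.
  by rewrite /= -mulnA leq_mul2r ltnS kN orbT.
elim: k s {kN} Ik sM => [|k IHk] s Is sM; have aM := cost_leq a sM.
  have [a0 Qs] := stop s Is; exists (cost s a), s.
  by split=> //; [apply: ExecWhileDone | rewrite mul1n mulnDl (leq_trans aM) ?leq_addr].
have [a0 wpc] := step k s Is; have [t1 [s1 [ex1 t1_le s1M I1]]] := wpc sM.
have [t2 [s2 [ex2 t2_le s2M Qs2]]] := IHk s1 I1 s1M.
exists (cost s a + t1 + t2), s2; split=> //; first exact: ExecWhileStep ex1 ex2.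
by rewrite mulSn leq_add // mulnDl leq_add.
Qed.

Lemma wp_for (n x b : nat) c s (Inv : seq 'I_n -> state -> Prop) Q :
    n <= N -> regs s b = n -> x \notin assigned c -> b \notin x :: assigned c ->
    Inv [::] (set_reg s x 0) ->
    (forall l (i : 'I_n) s', size l = i -> regs s' x = i -> frame (For x b c) s s' ->
       Inv l s' -> wp c s' (fun s'' => Inv (rcons l i) (set_reg s'' x i.+1))) ->
    (forall s', frame (For x b c) s s' -> Inv (enum 'I_n) s' -> Q s') ->
  wp (For x b c) s Q.
Proof.
move=> nN sb xc bc Inv0 step stop sM; have nM : n <= M by have [rM _] := sM; rewrite -sb.
have bfor : b \notin assigned (For x b c).
  by move: bc; rewrite /= !(inE, mem_cat) !negb_or => /andP[-> ->].
apply: wp_seq (sM); apply: wp_assign => //=; set s0 := set_reg s x _.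
pose loop_inv m s' := exists l, [/\ size l + m = n, l = take (size l) (enum 'I_n),
  frame (For x b c) s s', regs s' x = size l & Inv l s'].
apply: (wp_while (k := n) (Inv := loop_inv)) => //.
- exists [::]; rewrite take0; split=> //=; last by rewrite eqxx.
  by split=> //= y; rewrite inE => /norP[/negPf->].
- move=> m s' [l [size_l l_enum frame_s' s'x Inv_l]]; have [frame_regs _] := frame_s'.
  have l_lt : size l < n by lia.
  pose i := Ordinal l_lt; split; first by rewrite /= s'x frame_regs // sb; lia.
  have rcons_enum : rcons l i = take (size l).+1 (enum 'I_n).
    by rewrite (take_nth i) ?size_enum_ord // -l_enum (nth_ord_enum i i).
  apply: wp_frame; apply: wp_seq.
  apply: wp_frame; apply: wp_conseq (step l i s' erefl s'x frame_s' Inv_l) _.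
  move=> s1 Inv1 [frame1 _].
  have s1x : regs s1 x = i by rewrite frame1.
  apply: wp_assign => /=; rewrite s1x addn1; first exact: leq_trans l_lt nM.
  move=> frame2.
  exists (rcons l i); rewrite size_rcons.
  split=> //=; [by rewrite addSnnS | | by rewrite eqxx].
  apply: frame_trans frame_s' (frame_weaken _ _ frame2) => //= y yc.
  by rewrite inE yc orbT.
- move=> s' [l [/[!addn0] size_l l_enum frame_s' s'x Inv_l]].
  have [frame_regs _] := frame_s'.
  split; first by rewrite /= s'x frame_regs // sb size_l subnn.
  have l_all : l = enum 'I_n by rewrite l_enum take_oversize // size_enum_ord size_l.
  by apply: stop; rewrite // -l_all.
Qed.

End Triples.

(** * The kernelization program *)

Local Notation n_reg := 0 (only parsing).
Local Notation cap_reg := 1 (only parsing).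
Local Notation target_reg := 2 (only parsing).
Local Notation sqr_reg := 3 (only parsing).
Local Notation threshold_reg := 4 (only parsing).
Local Notation row_reg := 5 (only parsing).
Local Notation col_reg := 6 (only parsing).
Local Notation cell_reg := 7 (only parsing).
Local Notation bit_reg := 8 (only parsing).
Local Notation row_mark_reg := 9 (only parsing).
Local Notation col_mark_reg := 10 (only parsing).
Local Notation degree_reg := 11 (only parsing).
Local Notation kept_reg := 12 (only parsing).
Local Notation out_reg := 13 (only parsing).

(* The n rows of the adjacency matrix are followed by rows of marks, the k-th
   of which starts at the address [mark_base k]. *)
Fixpoint mark_base (k : nat) : expr :=
  if k is k'.+1 then mark_base k' [+] Reg n_reg else Reg sqr_reg.

Definition mark_at (k r : nat) : expr := mark_base k [+] Reg r.

Local Notation matched_at := (mark_at 0).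
Local Notation deleted_at := (mark_at 1).
Local Notation kept_at := (mark_at 2).

Definition for_row (c : cmd) : cmd := For col_reg n_reg (c ;; incr cell_reg).

Definition for_rows (c : cmd) : cmd := cell_reg ::= Const 0 ;; For row_reg n_reg c.

Definition for_cells (c : cmd) : cmd := for_rows (for_row c).

Definition square : cmd :=
  sqr_reg ::= Const 0 ;; For row_reg n_reg (sqr_reg ::= Reg sqr_reg [+] Reg n_reg).

Definition match_cell : cmd :=
  Read bit_reg (Reg cell_reg) ;;
  Read row_mark_reg (matched_at row_reg) ;;
  Read col_mark_reg (matched_at col_reg) ;;
  If (Reg bit_reg [-] Reg row_mark_reg [-] Reg col_mark_reg)
     (Write (matched_at row_reg) (Const 1) ;;
      Write (matched_at col_reg) (Const 1) ;;
      threshold_reg ::= Reg threshold_reg [+] Reg cap_reg [+] Reg cap_reg)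
     Skip.

Definition match_greedily : cmd := threshold_reg ::= Const 0 ;; for_cells match_cell.

Definition count_cell : cmd :=
  Read bit_reg (Reg cell_reg) ;;
  Read col_mark_reg (deleted_at col_reg) ;;
  degree_reg ::= Reg degree_reg
                 [+] (Reg bit_reg [-] Reg row_mark_reg [-] Reg col_mark_reg).

Definition count_neighbours : cmd :=
  degree_reg ::= Const 0 ;;
  Read row_mark_reg (deleted_at row_reg) ;;
  for_row count_cell.

Definition for_degrees (c : cmd) : cmd := for_rows (count_neighbours ;; c).

Definition prune_row : cmd :=
  If (Reg degree_reg [-] Reg threshold_reg)
     (Write (deleted_at row_reg) (Const 1) ;;
      target_reg ::= Reg target_reg [-] (Reg cap_reg [-] Const 1))
     Skip.

Definition keep_row : cmd :=
  If (Reg degree_reg) (Write (kept_at row_reg) (Const 1) ;; incr kept_reg) Skip.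

Definition mark_kept : cmd := kept_reg ::= Const 0 ;; for_degrees keep_row.

Definition emit_cell : cmd :=
  Read row_mark_reg (kept_at row_reg) ;;
  Read col_mark_reg (kept_at col_reg) ;;
  Read bit_reg (Reg cell_reg) ;;
  If (Reg row_mark_reg [+] Reg col_mark_reg [-] Const 1)
     (Write (Reg out_reg) (Reg bit_reg) ;; incr out_reg)
     Skip.

Definition emit : cmd := out_reg ::= Const 0 ;; for_cells emit_cell.

(* m - (m - n) is the minimum of m and n. *)
Definition set_target : cmd :=
  target_reg ::= Reg target_reg
                 [+] (Const 1 [-] (Const 1 [-] Reg n_reg) [-] Reg cap_reg) ;;
  target_reg ::= Reg target_reg
                 [-] (Reg target_reg [-] (Reg out_reg [+] Const 1)).

Definition kernelize_prog : cmd :=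
  square ;; match_greedily ;; for_degrees prune_row ;; mark_kept ;; emit ;; set_target ;;
  n_reg ::= Reg kept_reg.

Lemma eqn_cell (n r r' : nat) (i i' : 'I_n) :
  (r * n + i == r' * n + i') = (r == r') && (i == i').
Proof.
apply/eqP/andP => [E|[/eqP-> /eqP->] //].
by have := congr1 (edivn^~ n) E; rewrite !edivn_eq // => -[-> /val_inj->].
Qed.

Lemma cell_ltn (n : nat) (i j : 'I_n) : i * n + j < n * n.
Proof. have := ltn_ord i; have := ltn_ord j; nia. Qed.

Lemma frame_for_rows (c : cmd) (s s' : state) :
  frame c s s' -> frame (for_rows c) s s'.
Proof.
apply: frame_weaken => [x xc|]; last by rewrite /= orbF.
by rewrite /= !(inE, mem_cat) xc !orbT.
Qed.

Section Loops.

Variables M N n : nat.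
Hypotheses (n_le_N : n <= N) (sqr_n_le_M : n * n <= M).

Lemma wp_for_row (c : cmd) (k : nat) (s : state)
    (Inv : seq 'I_n -> state -> Prop) (Q : state -> Prop) :
    regs s n_reg = n -> regs s cell_reg = k -> k + n <= M ->
    all [predC assigned c] [:: n_reg; col_reg; cell_reg] ->
    (forall l s' x v, x \in [:: col_reg; cell_reg] ->
       Inv l s' -> Inv l (set_reg s' x v)) ->
    Inv [::] s ->
    (forall l (j : 'I_n) s', size l = j -> regs s' col_reg = j ->
       regs s' cell_reg = k + j -> frame (for_row c) s s' -> Inv l s' ->
       wp M N c s' (Inv (rcons l j))) ->
    (forall s', regs s' cell_reg = k + n -> frame (for_row c) s s' ->
       Inv (enum 'I_n) s' -> Q s') ->
  wp M N (for_row c) s Q.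
Proof.
move=> s_n s_cell knM /and4P[/= c_n c_col c_cell _] Inv_set Inv0 step stop.
apply: (wp_for (Inv := fun l s' => regs s' cell_reg = k + size l /\ Inv l s')) => //=.
- by rewrite !(inE, mem_cat) (negPf c_col).
- by rewrite !(inE, mem_cat) (negPf c_n).
- by rewrite addn0; split=> //; apply: Inv_set.
- move=> l j s1 size_l s1_col frame1 [s1_cell Inv1]; rewrite size_l in s1_cell.
  apply: wp_seq; apply: wp_frame.
  apply: wp_conseq (step l j s1 size_l s1_col s1_cell frame1 Inv1) _ => s2 Inv2 frame2.
  apply: wp_assign; rewrite /= frame2.1 // s1_cell addn1.
    by apply: leq_trans knM; rewrite -addnS leq_add2l.
  rewrite size_rcons size_l addnS; split=> //.
  by apply: (Inv_set) => //; apply: (Inv_set).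
- by move=> s' frame_s' [s'_cell Inv_s']; apply: stop; rewrite // s'_cell size_enum_ord.
Qed.

Lemma wp_for_rows (c : cmd) (s : state) (Inv : seq 'I_n -> state -> Prop)
    (Q : state -> Prop) :
    regs s n_reg = n -> all [predC assigned c] [:: n_reg; row_reg] ->
    (forall l s' x v, x \in [:: row_reg; cell_reg] ->
       Inv l s' -> Inv l (set_reg s' x v)) ->
    Inv [::] s ->
    (forall l (i : 'I_n) s', size l = i -> regs s' row_reg = i ->
       regs s' cell_reg = i * n -> frame (for_rows c) s s' -> Inv l s' ->
       wp M N c s' (fun s'' => regs s'' cell_reg = i.+1 * n /\ Inv (rcons l i) s'')) ->
    (forall s', frame (for_rows c) s s' -> Inv (enum 'I_n) s' -> Q s') ->
  wp M N (for_rows c) s Q.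
Proof.
move=> s_n /and3P[/= c_n c_row _] Inv_set Inv0 step stop.
apply: wp_seq; apply: wp_frame; apply: wp_assign => //= frame_cell.
have loop_frame s' :
    frame (For row_reg n_reg c) (set_reg s cell_reg 0) s' -> frame (for_rows c) s s'.
  move=> frame_loop; apply: frame_trans (frame_weaken _ _ frame_cell) _ => //.
    by move=> x; rewrite !inE => ->.
  apply: frame_weaken frame_loop => // x.
  exact: (mem_behead (s := assigned (for_rows c))).
apply: (wp_for (Inv := fun l s' => regs s' cell_reg = size l * n /\ Inv l s')) => //=.
- by split=> //; apply: (Inv_set) => //; apply: (Inv_set).
- move=> l i s' size_l s'_row frame_s' [s'_cell Inv_s']; rewrite size_l in s'_cell.
  apply: wp_conseq (step l i s' size_l s'_row s'_cell (loop_frame _ frame_s') Inv_s') _.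
  move=> s'' [s''_cell Inv_s'']; rewrite size_rcons size_l s''_cell; split=> //.
  exact: Inv_set.
- by move=> s' frame_s' [_ Inv_s']; apply: stop => //; apply: loop_frame.
Qed.

Lemma wp_for_cells (c : cmd) (s : state)
    (Inv : seq ('I_n * 'I_n) -> state -> Prop) (Q : state -> Prop) :
    regs s n_reg = n ->
    all [predC assigned c] [:: n_reg; row_reg; col_reg; cell_reg] ->
    (forall l s' x v, x \in [:: row_reg; col_reg; cell_reg] ->
       Inv l s' -> Inv l (set_reg s' x v)) ->
    Inv [::] s ->
    (forall l (i j : 'I_n) s', size l = i * n + j -> regs s' row_reg = i ->
       regs s' col_reg = j -> regs s' cell_reg = i * n + j ->
       frame (for_cells c) s s' -> Inv l s' ->
       wp M N c s' (Inv (rcons l (i, j)))) ->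
    (forall s', frame (for_cells c) s s' -> Inv (row_major 'I_n) s' -> Q s') ->
  wp M N (for_cells c) s Q.
Proof.
move=> s_n /and5P[/= c_n c_row c_col c_cell _] Inv_set Inv0 step stop.
pose rows l : seq ('I_n * 'I_n) := [seq (i, j) | i <- l, j <- enum 'I_n].
apply: (wp_for_rows (Inv := fun l => Inv (rows l))) => //=.
- by rewrite !(inE, mem_cat) (negPf c_n) (negPf c_row).
- move=> l s' x v x_in; apply: Inv_set.
  by move: x_in; rewrite !inE orbCA => ->; rewrite orbT.
- move=> l i s1 size_l s1_row s1_cell frame1 Inv1.
  have s1_n : regs s1 n_reg = n by rewrite frame1.1 //= !(inE, mem_cat) (negPf c_n).
  apply: (wp_for_row (k := i * n)
    (Inv := fun l' => Inv (rows l ++ [seq (i, j) | j <- l']))) => //=.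
  + by have := ltn_ord i; nia.
  + by rewrite c_n c_col c_cell.
  + by move=> l' s' x v x_in; apply: Inv_set; rewrite inE x_in orbT.
  + by rewrite cats0.
  + move=> l' j s2 size_l' s2_col s2_cell frame2 Inv2.
    have s2_row : regs s2 row_reg = i.
      by rewrite frame2.1 //= !(inE, mem_cat) (negPf c_row).
    rewrite map_rcons -rcons_cat; apply: step => //.
      by rewrite size_cat size_allpairs size_map size_enum_ord size_l size_l'.
    exact: frame_trans frame1 (frame_for_rows frame2).
  + by move=> s2 s2_cell _ Inv2; rewrite mulSnr /rows allpairs_rcons.
Qed.

End Loops.

Lemma adj_cellE (I : instance) (i j : 'I_(nvert I)) :
  adj_cell I (i * nvert I + j) = adj i j.
Proof.
congr nat_of_bool; apply/existsP/idP => [[x /existsP[y]]|ij].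
  by rewrite eqn_cell => /andP[/andP[/eqP/val_inj-> /eqP->]].
by exists i; apply/existsP; exists j; rewrite eqxx.
Qed.

Lemma adj_cell_out (I : instance) (p : nat) :
  nvert I * nvert I <= p -> adj_cell I p = 0.
Proof.
move=> np; rewrite /adj_cell; case: existsP => // -[x /existsP[y /andP[/eqP p_xy _]]].
by have := cell_ltn x y; rewrite -p_xy ltnNge np.
Qed.

Lemma outputs_matrix (s : state) (J : instance) :
    regs s n_reg = nvert J -> regs s cap_reg = capacity J ->
    regs s target_reg = target J ->
    (forall i j : 'I_(nvert J), memory s (i * nvert J + j) = adj i j) ->
  outputs s J.
Proof.
move=> s_n s_cap s_t matrix; split=> // p; rewrite -mulnn => p_lt.
have J_gt0 : 0 < nvert J by lia.
have row_lt : p %/ nvert J < nvert J by rewrite ltn_divLR.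
have col_lt : p %% nvert J < nvert J by rewrite ltn_mod.
rewrite (divn_eq p (nvert J)) (matrix (Ordinal row_lt) (Ordinal col_lt)).
by rewrite (adj_cellE (Ordinal row_lt) (Ordinal col_lt)).
Qed.

(** * Correctness of the program *)

Definition value_bound (I : instance) : nat :=
  (nvert I + capacity I + target I + 1) ^ 2.

Section Correctness.

Variable I : instance.

Let n := nvert I.
Let cap := capacity I.
Let e : rel 'I_n := @adj I.
Let M := value_bound I.

Let sqr_n_le_M : n * n <= M. Proof. by rewrite /M /value_bound -mulnn; nia. Qed.
Let n_le_M : n <= M. Proof. by rewrite /M /value_bound -mulnn; nia. Qed.
Let n_cap_le_M : n * cap <= M. Proof. by rewrite /M /value_bound -mulnn; nia. Qed.
Let target_lt_M : target I < M. Proof. by rewrite /M /value_bound -mulnn; nia. Qed.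

Local Notation wp := (wp M n).

Definition constants (s : state) : Prop :=
  [/\ regs s n_reg = n, regs s cap_reg = cap & regs s sqr_reg = n * n].

(* A lists the sets of matched, deleted and kept vertices, as far as they are
   marked; all further rows of marks are clear. *)
Definition layout (s : state) (A : seq {set 'I_n}) : Prop :=
  (forall i j : 'I_n, memory s (i * n + j) = e i j) /\
  (forall k (i : 'I_n), memory s ((n + k) * n + i) = (i \in nth set0 A k)).

Lemma constants_frame (c : cmd) (s s' : state) :
    all [predC assigned c] [:: n_reg; cap_reg; sqr_reg] ->
  frame c s s' -> constants s -> constants s'.
Proof.
by move=> /and4P[/= c0 c1 c3 _] [frame_regs _] [s0 s1 s3]; split; rewrite frame_regs.
Qed.

Lemma layout_mark (s : state) (A : seq {set 'I_n}) (k : nat) (i : 'I_n) :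
  layout s A ->
  layout (set_mem s ((n + k) * n + i) 1) (set_nth set0 A k (i |: nth set0 A k)).
Proof.
move=> [matrix marks]; split=> [a b|l j]; rewrite /= eqn_cell.
  by rewrite ltn_eqF ?matrix // (leq_trans (ltn_ord a)) ?leq_addr.
rewrite nth_set_nth /= eqn_add2l; case: eqVneq => [->|] /=; last by rewrite marks.
by rewrite in_setU1 marks; case: eqP.
Qed.

Lemma eval_mark_at (s : state) (k r : nat) :
  constants s -> eval s (mark_at k r) = (n + k) * n + regs s r.
Proof.
move=> [s0 _ s3]; rewrite /mark_at /=; congr (_ + _).
elim: k => [|k IHk] /=; first by rewrite s3 addn0.
by rewrite IHk s0 addnS mulSn addnC.
Qed.

Lemma wp_square (s : state) (Q : state -> Prop) :
    regs s n_reg = n ->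
    (forall s', regs s' sqr_reg = n * n -> frame square s s' -> Q s') ->
  wp square s Q.
Proof.
move=> s_n stop; apply: wp_frame; apply: wp_seq; apply: wp_assign => //=.
apply: (wp_for (Inv := fun (l : seq 'I_n) s' => regs s' sqr_reg = size l * n)) => //=.
  move=> l i s' size_l _ frame_s' s'_sqr.
  apply: wp_assign; rewrite /= s'_sqr frame_s'.1 //= s_n.
    by have := ltn_ord i; rewrite size_l; nia.
  by rewrite size_rcons mulSn addnC.
by move=> s' _; rewrite size_enum_ord; apply: stop.
Qed.

Lemma wp_match_cell (s : state) (X : {set 'I_n}) (i j : 'I_n) :
    constants s -> layout s [:: X; set0; set0] ->
    regs s row_reg = i -> regs s col_reg = j -> regs s cell_reg = i * n + j ->
    regs s threshold_reg = #|X| * cap ->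
  wp match_cell s (fun s' =>
    layout s' [:: match_pair e X (i, j); set0; set0] /\
    regs s' threshold_reg = #|match_pair e X (i, j)| * cap).
Proof.
move=> cs lay s_row s_col s_cell s_thr; have [matrix marks] := lay.
apply: wp_seq; apply: wp_read; rewrite [eval _ _]/= s_cell matrix.
apply: wp_seq; apply: wp_read; rewrite eval_mark_at //= s_row marks.
apply: wp_seq; apply: wp_read; rewrite eval_mark_at //= s_col marks.
apply: wp_if => /=; last first.
  move=> unmatchable; apply: wp_skip; rewrite /match_pair /=.
  by move: unmatchable; case: (e i j) (i \in X) (j \in X) => [] [] [].
move=> matchable; have [eij iX jX] : [/\ e i j, i \notin X & j \notin X].
  by move: matchable; case: (e i j) (i \in X) (j \in X) => [] [] [].
have X'_cap : #|match_pair e X (i, j)| * cap = #|X| * cap + cap + cap.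
  by rewrite (card_match_pair (@adj_irr I)) // !mulSnr.
have X'_n : #|match_pair e X (i, j)| <= n by rewrite -[n in _ <= n]card_ord max_card.
apply: wp_seq; apply: wp_write; first by rewrite /=; lia.
rewrite eval_mark_at //= s_row.
apply: wp_seq; apply: wp_write; first by rewrite /=; lia.
rewrite eval_mark_at //= s_col.
have [_ s_cap _] := cs; apply: wp_assign; rewrite /= s_thr s_cap -X'_cap.
  by apply: leq_trans n_cap_le_M; rewrite leq_mul2r X'_n orbT.
split=> //.
rewrite /match_pair eij iX jX /= setUCA.
exact: layout_mark 0 j (layout_mark 0 i lay).
Qed.

Lemma wp_match_greedily (s : state) (Q : state -> Prop) :
    constants s -> layout s [:: set0; set0; set0] ->
    (forall s', frame match_greedily s s' -> layout s' [:: matched e; set0; set0] ->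
       regs s' threshold_reg = #|matched e| * cap -> Q s') ->
  wp match_greedily s Q.
Proof.
move=> cs lay stop; have [s_n _ _] := cs.
apply: wp_frame; apply: wp_seq; apply: wp_assign => //.
apply: (wp_for_cells (leqnn n) sqr_n_le_M (Inv := fun l s' =>
  layout s' [:: matched_by e l; set0; set0] /\
  regs s' threshold_reg = #|matched_by e l| * cap)) => //=.
- by move=> l s' x v; rewrite !inE => /or3P[] /eqP->.
- by rewrite cards0.
- move=> l i j s1 size_l s1_row s1_col s1_cell frame1 [lay1 s1_thr].
  rewrite matched_by_rcons; apply: wp_match_cell => //.
  exact: constants_frame frame1 cs.
- by move=> s' _ [lay' s'_thr] frame_s'; apply: stop.
Qed.

Lemma wp_count_neighbours (s : state) (X D K : {set 'I_n}) (v : 'I_n) :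
    constants s -> layout s [:: X; D; K] ->
    regs s row_reg = v -> regs s cell_reg = v * n ->
  wp count_neighbours s (fun s' =>
    regs s' degree_reg = #|neighbours (delete e D) v| /\
    regs s' cell_reg = v.+1 * n).
Proof.
move=> cs [matrix marks] s_row s_cell; have [s_n _ _] := cs.
apply: wp_seq; apply: wp_assign => //=.
apply: wp_seq; apply: wp_read; rewrite eval_mark_at //= s_row marks /=.
apply: (wp_for_row (leqnn n) (k := v * n) (Inv := fun l s' =>
  regs s' degree_reg = count [in neighbours (delete e D) v] l)) => //=.
- by have := ltn_ord v; nia.
- by move=> l s' x v'; rewrite !inE => /orP[] /eqP->.
- move=> l j s1 size_l s1_col s1_cell frame1 s1_degree.
  have cs1 : constants s1 by apply: constants_frame frame1 cs.
  have m1 : memory s1 = memory s by rewrite frame1.2.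
  apply: wp_seq; apply: wp_read; rewrite [eval _ _]/= s1_cell m1 matrix.
  apply: wp_seq; apply: wp_read; rewrite eval_mark_at //= s1_col m1 marks /=.
  have delete_bit : e v j - (v \in D) - (j \in D) = delete e D v j.
    by rewrite /delete; case: (e v j) (v \in D) (j \in D) => [] [] [].
  have degree_lt : count [in neighbours (delete e D) v] l < n.
    by apply: leq_ltn_trans (count_size _ _) _; rewrite size_l.
  apply: wp_assign; rewrite /= s1_degree frame1.1 //= delete_bit.
    by apply/leq_trans/n_le_M/(leq_trans _ degree_lt); rewrite -addn1 leq_add2l leq_b1.
  by rewrite -cats1 count_cat /= inE addn0.
- move=> s' s'_cell _ s'_degree; rewrite s'_degree s'_cell mulSn addnC.
  by rewrite card_count_enum.
Qed.

Lemma wp_for_degrees (c : cmd) (s : state) (X : {set 'I_n})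
    (D K : seq 'I_n -> {set 'I_n}) (r : nat) (f : seq 'I_n -> nat) (Q : state -> Prop) :
    all [predC assigned c] [:: n_reg; cap_reg; sqr_reg; row_reg; cell_reg] ->
    r \notin row_reg :: assigned count_neighbours ->
    constants s -> layout s [:: X; D [::]; K [::]] -> regs s r = f [::] ->
    (forall l (v : 'I_n) s', size l = v -> constants s' ->
       frame (for_degrees c) s s' -> layout s' [:: X; D l; K l] ->
       regs s' row_reg = v -> regs s' r = f l ->
       regs s' degree_reg = #|neighbours (delete e (D l)) v| ->
       wp c s' (fun s'' => layout s'' [:: X; D (rcons l v); K (rcons l v)] /\
                           regs s'' r = f (rcons l v))) ->
    (forall s', frame (for_degrees c) s s' ->
       layout s' [:: X; D (enum 'I_n); K (enum 'I_n)] -> regs s' r = f (enum 'I_n) ->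
       Q s') ->
  wp (for_degrees c) s Q.
Proof.
move=> /and5P[/= c_n c_cap c_sqr c_row /andP[c_cell _]].
rewrite inE => /norP[/negPf r_row r_count] cs lay s_r step stop; have [s_n _ _] := cs.
have r_cell : r == cell_reg = false by apply: contraNF r_count => /eqP->.
apply: (wp_for_rows (leqnn n)
  (Inv := fun l s' => layout s' [:: X; D l; K l] /\ regs s' r = f l)) => //.
- by rewrite /= !(inE, mem_cat) (negPf c_n) (negPf c_row).
- move=> l s' x v; rewrite !inE => x_in [lay' s'_r]; split=> //=.
  by case/orP: x_in => /eqP->; rewrite ?r_row ?r_cell.
- move=> l v s1 size_l s1_row s1_cell frame1 [lay1 s1_r].
  have cs1 : constants s1.
    by apply: constants_frame frame1 cs; rewrite /= !(inE, mem_cat) (negPf c_n)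
      (negPf c_cap) (negPf c_sqr).
  apply: wp_seq; apply: wp_frame.
  apply: wp_conseq (wp_count_neighbours cs1 lay1 s1_row s1_cell) _.
  move=> s2 [s2_degree s2_cell] frame2.
  have cs2 : constants s2 by apply: constants_frame frame2 cs1.
  have s2_row : regs s2 row_reg = v by rewrite frame2.1.
  have s2_r : regs s2 r = f l by rewrite frame2.1.
  have lay2 : layout s2 [:: X; D l; K l] by rewrite /layout frame2.2.
  have {}frame2 : frame (for_degrees c) s s2.
    apply: frame_trans frame1 (frame_for_rows (frame_weaken _ _ frame2)) => //.
    by move=> x x_in; rewrite mem_cat x_in.
  apply: wp_frame.
  apply: wp_conseq (step l v s2 size_l cs2 frame2 lay2 s2_row s2_r s2_degree) _.
  by move=> s3 [lay3 s3_r] frame3; rewrite frame3.1.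
- by move=> s' frame_s' [lay' s'_r]; apply: stop.
Qed.

Lemma wp_prune (s : state) (X : {set 'I_n}) (d : nat) (Q : state -> Prop) :
    constants s -> layout s [:: X; set0; set0] ->
    regs s threshold_reg = d -> regs s target_reg = target I ->
    (forall s', frame (for_degrees prune_row) s s' ->
       layout s' [:: X; pruned e d; set0] ->
       regs s' target_reg = target I - #|pruned e d| * cap.-1 -> Q s') ->
  wp (for_degrees prune_row) s Q.
Proof.
move=> cs lay s_thr s_t stop.
apply: (wp_for_degrees (X := X) (D := pruned_by e d) (K := fun=> set0) (r := target_reg)
  (f := fun l => target I - #|pruned_by e d l| * cap.-1)) => //.
  by rewrite s_t cards0 subn0.
move=> l v s1 _ cs1 frame1 lay1 s1_row s1_t s1_degree; have [_ s1_cap _] := cs1.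
have s1_thr : regs s1 threshold_reg = d by rewrite frame1.1.
rewrite pruned_by_rcons /prune_vertex; case: ltnP => degree_v.
  apply: wp_if; rewrite /= s1_degree s1_thr; last lia.
  move=> _; apply: wp_seq; apply: wp_write; first by rewrite /=; lia.
  rewrite eval_mark_at // s1_row.
  apply: wp_assign; rewrite /= s1_t s1_cap subn1 -subnDA; first lia.
  split; first exact: layout_mark 1 v lay1.
  by rewrite cardsU1 (high_degree_notin degree_v) mulSn addnC.
by apply: wp_if; rewrite /= s1_degree s1_thr; [lia | move=> _; apply: wp_skip].
Qed.

Lemma wp_mark_kept (s : state) (X D : {set 'I_n}) (Q : state -> Prop) :
    constants s -> layout s [:: X; D; set0] ->
    (forall s', frame mark_kept s s' ->
       layout s' [:: X; D; nonisolated (delete e D)] ->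
       regs s' kept_reg = #|nonisolated (delete e D)| -> Q s') ->
  wp mark_kept s Q.
Proof.
move=> cs lay stop; set K := nonisolated _ in stop *.
pose marked (l : seq 'I_n) := [set x in l | x \in K].
have marked_enum : marked (enum 'I_n) = K.
  by apply/setP => x; rewrite inE mem_enum.
apply: wp_frame; apply: wp_seq; apply: wp_assign => //.
apply: (wp_for_degrees (X := X) (D := fun=> D) (K := marked) (r := kept_reg)
  (f := fun l => count [in K] l)) => //.
- move=> l v s1 size_l cs1 _ lay1 s1_row s1_kept s1_degree.
  rewrite /marked set_in_rcons -cats1 count_cat /= addn0 inE.
  case: posnP => degree_v.
    by apply: wp_if; rewrite /= s1_degree // addn0 => _; apply: wp_skip.
  apply: wp_if; rewrite /= s1_degree; last lia.
  move=> _; apply: wp_seq; apply: wp_write; first by rewrite /=; lia.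
  rewrite eval_mark_at // s1_row; apply: wp_assign; rewrite /= s1_kept.
    apply: leq_trans n_le_M; rewrite addn1; apply: leq_ltn_trans (count_size _ _) _.
    by rewrite size_l.
  by split; first exact: layout_mark 2 v lay1.
- move=> s' _ lay' s'_kept frame_s'; apply: stop; rewrite // ?card_count_enum //.
  by rewrite -marked_enum.
Qed.

(* The first k cells of the matrix in s0 have been read and o has been written. *)
Definition emitted (s0 : state) (k : nat) (o : seq nat) (s : state) : Prop :=
  [/\ regs s out_reg = size o, size o <= k,
      forall p, k <= p -> memory s p = memory s0 p
    & forall p, p < size o -> memory s p = nth 0 o p].

(* The output is never longer than the part of the matrix already read, so it
   can be written over the matrix. *)
Lemma wp_emit_cell (s0 s : state) (X D K : {set 'I_n}) (i j : 'I_n) (o : seq nat) :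
    layout s0 [:: X; D; K] -> constants s ->
    regs s row_reg = i -> regs s col_reg = j -> regs s cell_reg = i * n + j ->
    emitted s0 (i * n + j) o s ->
  wp emit_cell s (emitted s0 (i * n + j).+1
    (if (i \in K) && (j \in K) then rcons o (e i j) else o)).
Proof.
move=> [matrix marks] cs s_row s_col s_cell [s_out o_le unread written].
have ij_lt := cell_ltn i j.
have kept_mark (x : 'I_n) : memory s ((n + 2) * n + x) = (x \in K).
  by rewrite unread ?marks //; nia.
apply: wp_seq; apply: wp_read; rewrite eval_mark_at //= s_row kept_mark.
apply: wp_seq; apply: wp_read; rewrite eval_mark_at //= s_col kept_mark.
apply: wp_seq; apply: wp_read; rewrite /= s_cell unread // matrix.
apply: wp_if; rewrite /= => both_kept; last first.
  apply: wp_skip; rewrite ifF; last by move: both_kept; do 2!case: (_ \in K).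
  by split=> //= [|p ij_p]; [lia | apply: unread; lia].
rewrite ifT; last by move: both_kept; do 2!case: (_ \in K).
apply: wp_seq; apply: wp_write; first by rewrite /=; case: (e i j); lia.
rewrite /= s_out; apply: wp_assign; rewrite /= s_out; first lia.
split; rewrite /= ?size_rcons ?addn1 // => p p_bound.
  by rewrite ifF; [apply: unread; lia | lia].
rewrite nth_rcons; case: eqVneq => [->|p_o]; first by rewrite ltnn.
by rewrite ifT; [apply: written; lia | lia].
Qed.

Lemma wp_emit (s : state) (X D K : {set 'I_n}) (Q : state -> Prop) :
    layout s [:: X; D; K] -> constants s ->
    (forall s', frame emit s s' -> regs s' out_reg = #|K| ^ 2 ->
       (forall a b : 'I_#|K|,
          memory s' (a * #|K| + b) = e (enum_val a) (enum_val b)) -> Q s') ->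
  wp emit s Q.
Proof.
move=> lay cs stop; have [s_n _ _] := cs.
pose out (l : seq ('I_n * 'I_n)) : seq nat :=
  [seq e p.1 p.2 : nat | p <- l & (p.1 \in K) && (p.2 \in K)].
apply: wp_frame; apply: wp_seq; apply: wp_assign => //.
apply: (wp_for_cells (leqnn n) sqr_n_le_M
  (Inv := fun l => emitted s (size l) (out l))) => //.
- by move=> l s' x v; rewrite !inE => /or3P[] /eqP->.
- move=> l i j s1 size_l s1_row s1_col s1_cell frame1 emitted1.
  have cs1 : constants s1 by apply: constants_frame frame1 cs.
  rewrite size_rcons /out filter_rcons (fun_if (map _)) map_rcons size_l.
  by apply: wp_emit_cell lay cs1 _ _ _ _ => //; rewrite -size_l.
- move=> s' _ [s'_out _ _ written] frame_s'.
  have out_all : out (row_major 'I_n) = [seq e x y : nat | x <- enum K, y <- enum K].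
    by rewrite /out /row_major filter_allpairs map_allpairs /= !enumT.
  rewrite out_all size_allpairs -cardE in s'_out written.
  apply: stop => // a b; have [a_lt b_lt] := (ltn_ord a, ltn_ord b).
  rewrite written; last exact: cell_ltn.
  have x0 := enum_val a; rewrite !(enum_val_nth x0).
  have := nth_allpairs (fun x y => nat_of_bool (e x y)) x0 x0 0
    (s := enum K) (t := enum K).
  by rewrite -cardE; apply.
Qed.

Lemma kept_notin_deleted (x : 'I_n) : x \in kept I -> x \notin deleted I.
Proof.
apply: contraTN => xD.
by rewrite inE -leqNgt leqn0 (neighbours_delete_deleted _ xD) cards0.
Qed.

Lemma layout_input (s : state) :
  memory s = memory (input_state I) -> layout s [:: set0; set0; set0].
Proof.
move=> m; split=> [i j|k i]; rewrite m; first exact: adj_cellE.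
rewrite [memory _ _]adj_cell_out; last by rewrite mulnDl -addnA leq_addr.
by case: k => [|[|[|k]]]; rewrite /= ?nth_nil inE.
Qed.

Lemma wp_kernelize_prog :
  wp kernelize_prog (input_state I) (outputs^~ (kernelize I)).
Proof.
apply: wp_seq; apply: wp_square => // s1 s1_sqr frame1.
have cs1 : constants s1 by split; rewrite // frame1.1.
have lay1 : layout s1 [:: set0; set0; set0] by apply: layout_input; rewrite frame1.2.
apply: wp_seq; apply: (wp_match_greedily cs1 lay1) => s2 frame2 lay2 s2_thr.
have cs2 : constants s2 by apply: constants_frame frame2 cs1.
have s2_t : regs s2 target_reg = target I by rewrite frame2.1 // frame1.1.
apply: wp_seq; apply: (wp_prune cs2 lay2 s2_thr s2_t) => s3 frame3 lay3 s3_t.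
have cs3 : constants s3 by apply: constants_frame frame3 cs2.
apply: wp_seq; apply: (wp_mark_kept cs3 lay3) => s4 frame4 lay4 s4_kept.
have cs4 : constants s4 by apply: constants_frame frame4 cs3.
apply: wp_seq; apply: (wp_emit lay4 cs4) => s5 frame5 s5_out s5_matrix.
have [s5_n s5_cap _] : constants s5 by apply: constants_frame frame5 cs4.
have s5_kept : regs s5 kept_reg = #|kept I| by rewrite frame5.1.
have s5_t : regs s5 target_reg = target I - #|deleted I| * cap.-1.
  by rewrite frame5.1 // frame4.1.
have kept_le : #|kept I| <= n by rewrite -[n in _ <= n]card_ord max_card.
apply: wp_seq; apply: wp_seq; apply: wp_assign; rewrite /= s5_t s5_n s5_cap; first lia.
apply: wp_assign; rewrite /= s5_out; first lia.
apply: wp_assign; rewrite /= s5_kept; first lia.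
apply: outputs_matrix => //=; first by rewrite -!minnE addn1.
move=> a b; rewrite s5_matrix /kernel_adj /= /reduced_adj /delete.
by rewrite !kept_notin_deleted ?enum_valP // !andbT.
Qed.

End Correctness.

Lemma bounded_input (I : instance) : bounded (value_bound I) (input_state I).
Proof.
have bound : nvert I + capacity I + target I + 1 <= value_bound I.
  by rewrite /value_bound -mulnn leq_pmulr ?addn1.
split=> [[|[|[|x]]]|p] /=; rewrite ?nth_nil; [lia.. |].
by apply: leq_trans (leq_b1 _) _; lia.
Qed.

Lemma bitlen_value_bound (I : instance) : bitlen (value_bound I) <= 4 * instance_size I.
Proof.
have bitlen_sum : bitlen (nvert I + capacity I + target I + 1) <= 2 * instance_size I.
  have := bitlenD (nvert I + capacity I + target I) 1.
  have := bitlenD (nvert I + capacity I) (target I).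
  have := bitlenD (nvert I) (capacity I).
  have : bitlen 1 = 1 by rewrite /bitlen trunc_log1.
  have : 0 < bitlen (nvert I) by [].
  by rewrite /instance_size; lia.
rewrite /value_bound -mulnn; apply: leq_trans (bitlenM _ _) _; lia.
Qed.

Lemma polynomial_time_kernelize : polynomial_time kernelize.
Proof.
exists kernelize_prog, (4 * time_bound 0 kernelize_prog), (loop_depth kernelize_prog).+1.
move=> I; have [t [s [ex t_le _ out]]] := wp_kernelize_prog (bounded_input I).
exists t, s; split=> //; apply: leq_trans t_le _.
have N_size : (nvert I).+1 <= instance_size I.
  by rewrite /instance_size /bitlen -mulnn; nia.
have time_le : time_bound (nvert I) kernelize_prog
    <= time_bound 0 kernelize_prog * instance_size I ^ loop_depth kernelize_prog.
  by apply: leq_trans (time_bound_leq _ _) _; rewrite leq_mul2l leq_exp2r ?N_size ?orbT.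
apply: leq_trans (leq_mul time_le (bitlen_value_bound I)) _.
by rewrite expnSr mulnACA [_ * 4]mulnC.
Qed.

Lemma kernelize_size_bounded :
  exists g : nat -> nat, forall I, instance_size (kernelize I) <= g (parameter I).
Proof.
pose k p := 8 * (p ^ 2 * p).
exists (fun p => k p ^ 2 + bitlen (k p) + bitlen p + bitlen (k p ^ 2).+1) => I.
have [vc_le cap_le] : vc_number I <= parameter I /\ capacity I <= parameter I.
  by rewrite leq_addr leq_addl.
have n_le : nvert (kernelize I) <= k (parameter I).
  by apply: leq_trans (nvert_kernelize I) _; rewrite leq_mul2l leq_mul ?leq_sqr.
have n2_le : nvert (kernelize I) ^ 2 <= k (parameter I) ^ 2 by rewrite leq_sqr.
rewrite /instance_size !leq_add ?bitlen_mono //.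
exact: leq_trans (geq_minr _ _) _.
Qed.

Theorem theorem1p5 :
  exists f : instance -> instance,
    kernel f /\
    exists c : nat, forall I : instance,
      nvert (f I) <= c * (vc_number I ^ 2 * capacity I).
Proof.
exists kernelize; split; last by exists 8; apply: nvert_kernelize.
split; [exact: polynomial_time_kernelize | exact: kernelize_equivalent
       | exact: kernelize_size_bounded].
Qed.
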